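(* Let $\mu$ be a probability measure on $\mathcal{X}$ and let $S$ be a class of classifiers on $\mathcal{X}$ such that, for some positive constants $K_1,K_2,\varepsilon_0$ and $r$, $$K_2\varepsilon^{-r}\le H_1(\varepsilon,S,\mu)\le K_1\varepsilon^{-r}\qquad\text{for all }0<\varepsilon\le\varepsilon_0,$$ where $H_1(\cdot,S,\mu)$ denotes the $\mathbb{L}_1(\mu)$-metric entropy of $S$. Then there exists a positive constant $K$ depending on $K_1,K_2,\varepsilon_0$ and $r$ such that $$R_n(h,S,\mu)\ge K(1-h)^{1/(1+r)}\left[\left(h^{-(1-r)/(1+r)}n^{-1/(1+r)}\right)\wedge n^{-1/2}\right],$$ whenever $n\ge2$, where $R_n(h,S,\mu)=\inf_{\hat s\in S}\sup_{P\in\mathcal{P}(h,S,\mu)}\mathbb{E}[\ell(s^*,\hat s)]$ and $h\in[0,1]$.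
   Context: Binary classification setting: one observes $n$ independent copies $(X_1,Y_1),\dots,(X_n,Y_n)$ of a pair $(X,Y)$ with distribution $P$ on $\mathcal{X}\times\{0,1\}$, $\mathcal{X}$ a measurable space. A classifier is a measurable map $t:\mathcal{X}\to\{0,1\}$; $\eta(x)=P[Y=1\mid X=x]$ is the regression function, $s^*(x)=\mathbb{1}_{\eta(x)\ge1/2}$ is the Bayes classifier (both depend on $P$), and $\ell(s^*,t)=P(Y\ne t(X))-P(Y\ne s^*(X))$. $\mathcal{P}(h,S,\mu)$ is the set of probability distributions $P$ on $\mathcal{X}\times\{0,1\}$ whose first marginal is $\mu$ and such that $|2\eta(x)-1|\ge h$ for all $x\in\mathcal{X}$ and $s^*\in S$. In the definition of $R_n(h,S,\mu)$ the infimum is over all estimators $\hat s$ based on the $n$-sample and taking their values in $S$; the expectation is under the sample having distribution $P^{\otimes n}$. $H_1(\varepsilon,S,\mu)$ is the logarithm of the maximal number $N$ of functions $t_1,\dots,t_N$ belonging to $S$ such that $\|t_i-t_j\|_1>\varepsilon$ for every $i\ne j$, where $\|\cdot\|_1$ is the $\mathbb{L}_1(\mu)$-norm. $a\wedge b=\min(a,b)$; a negative power of $h$ at $h=0$ is read as $+\infty$. *)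

(* Defs.v *)
(* MathComp / MathComp-Analysis *)
From HB Require Import structures.
From mathcomp Require Import all_boot all_order all_algebra.
From mathcomp Require Import all_classical all_reals all_analysis.

Set Implicit Arguments.
Unset Strict Implicit.
Unset Printing Implicit Defensive.

Import Order.TTheory GRing.Theory Num.Theory.
Import numFieldNormedType.Exports.

Local Open Scope classical_set_scope.
Local Open Scope ring_scope.

Section power_measure.
Context d (Z : measurableType d) (R : realType).

Definition tuple_cons n (x : Z * n.-tuple Z) : n.+1.-tuple Z :=
  [tuple of x.1 :: x.2].

Lemma measurable_tuple_cons n : measurable_fun [set: Z * n.-tuple Z] (@tuple_cons n).
Proof. exact: measurable_cons. Qed.

HB.instance Definition _ n :=
  isMeasurableFun.Build _ _ _ _ (@tuple_cons n) (@measurable_tuple_cons n).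

(* The n-fold product of P, as a law on n-tuples with their product
   sigma-algebra; product_power_box below characterizes it. *)
Fixpoint product_power (P : probability Z R) (n : nat) :
    probability (n.-tuple Z) R :=
  match n with
  | 0 => dirac [tuple of [::]]
  | m.+1 => distribution (P \x product_power P m)%E (@tuple_cons m)
  end.

Lemma product_power_box (P : probability Z R) n (A : 'I_n -> set Z) :
  (forall i, measurable (A i)) ->
  product_power P n [set w | forall i, A i (tnth w i)] =
  (\prod_(i < n) P (A i))%E.
Proof.
elim: n A => [|n IH] A mA.
  rewrite big_ord0 /= diracE mem_set//=; first by case.
rewrite big_ord_recl -IH => [|i]; last exact: mA.
rewrite /= /distribution /pushforward/= -product_measure1E//; last first.
  have -> : [set w : n.-tuple Z | forall i, A (lift ord0 i) (tnth w i)] =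
      \bigcap_(i in [set: 'I_n]) ((@tnth n Z)^~ i @^-1` A (lift ord0 i)).
    by apply/seteqP; split=> w /= h i; [move=> _; exact: h|exact: h].
  apply: fin_bigcap_measurable => // i _.
  rewrite -[X in measurable X]setTI.
  exact: measurable_tnth.
congr (product_measure1 _ _ _); apply/seteqP; split=> -[z w] /= h.
  split; first by have := h ord0.
  by move=> i; have := h (lift ord0 i); rewrite /tuple_cons tnthS.
move=> i; case: (unliftP ord0 i) => [j ->|->]; last exact: h.1.
by rewrite /tuple_cons tnthS; exact: h.2.
Qed.

End power_measure.

Section classification.
Context d (T : measurableType d) (R : realType).
Implicit Types (mu : probability T R) (P : probability (T * bool)%type R).
Implicit Types (S : set (T -> bool)) (s t : T -> bool) (eta : T -> R).

(* eta is a version of x |-> P[Y = 1 | X = x] *)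
Definition regression_function P eta : Prop :=
  [/\ measurable_fun [set: T] eta,
      forall x, 0 <= eta x <= 1 &
      forall A, measurable A ->
        P (A `*` [set true]) =
        (\int[P]_(z in A `*` [set: bool]) (eta z.1)%:E)%E].

Definition bayes_classifier eta : T -> bool := fun x => 2^-1 <= eta x.

Definition risk P t : R := fine (P [set z | z.2 != t z.1]).

Definition excess_risk P s t : R := risk P t - risk P s.

(* The regression function is only determined up to a null set, whereas the
   conditions below are pointwise, so the laws of the class are paired with a
   version of it. The Bayes risk does not depend on the version. *)
Definition margin_class (h : R) S mu :
    set (probability (T * bool)%type R * (T -> R)) :=
  [set Q | [/\ regression_function Q.1 Q.2,
               forall A, measurable A -> Q.1 (A `*` [set: bool]) = mu A,
               forall x, h <= `|2 * Q.2 x - 1| &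
               S (bayes_classifier Q.2)]].

(* The only measurability required is that the loss be a random variable under
   each law of the class, so that its expectation makes sense. *)
Definition estimator (n : nat) (h : R) S mu :
    set (n.-tuple (T * bool) -> T -> bool) :=
  [set shat | (forall w, S (shat w)) /\
     forall Q, margin_class h S mu Q ->
       measurable_fun [set: n.-tuple (T * bool)]
         (fun w => excess_risk Q.1 (bayes_classifier Q.2) (shat w))].

Definition minimax_risk (n : nat) (h : R) S mu : \bar R :=
  ereal_inf [set
    ereal_sup [set ('E_(product_power Q.1 n)
                     [(fun w => excess_risk Q.1 (bayes_classifier Q.2) (shat w))])%E
              | Q in margin_class h S mu]
    | shat in @estimator n h S mu].

Definition L1_dist mu s t : \bar R :=
  ('N[mu]_1 [(fun x => ((s x)%:R - (t x)%:R)%:E)])%E.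

Definition separated (eps : R) S mu (N : nat) : Prop :=
  exists t : 'I_N -> T -> bool,
    (forall i, S (t i)) /\
    forall i j, i != j -> (eps%:E < L1_dist mu (t i) (t j))%E.

(* +oo when there are arbitrarily large separated families *)
Definition L1_entropy (eps : R) S mu : \bar R :=
  lne (ereal_sup [set N%:R%:E | N in separated eps S mu]).

End classification.

(* powR sends 0 to 0 for negative exponents; here the value is +oo *)
Definition powR_pinfty (R : realType) (x a : R) : \bar R :=
  if (x == 0) && (a < 0) then +oo%E else (x `^ a)%:E.

(* Main.v *)
(* For a classifier t, let P_t be the law of (X, Y) with X ~ mu and Y = t X
   flipped with probability (1 - h) / 2. Under P_t the Bayes classifier is t and
   the excess risk of s is h * mu (s <> t), while the chi-square divergence of
   P_t from P_s is 4 h^2 / (1 - h^2) * mu (s <> t).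
   The two-sided entropy bound yields, by pigeonhole over the cells of a coarser
   maximal separated family, many eps-separated t_i in S inside a single ball of
   radius O(eps). If an estimator is eps/2-close to t_i on the event A_i, these
   events are disjoint, so one of the N events has mass at most 1/N under the
   product law of the center of the ball; the second moment of the likelihood
   ratio transfers this to the product of P_{t_i}. Balancing gives eps of order
   ((1 - h) / (n h^2))^(1 / (1 + r)); for h below n^(-1/2) the
   bound for the smaller class with margin n^(-1/2) is used instead. *)
From HB Require Import structures.
Require Import Defs.
From mathcomp Require Import all_boot all_order all_algebra.
From mathcomp Require Import all_classical all_reals all_analysis.
From mathcomp Require Import measurable_realfun ring lra.

Set Implicit Arguments.
Unset Strict Implicit.
Unset Printing Implicit Defensive.

Import Order.TTheory GRing.Theory Num.Theory.
Import numFieldNormedType.Exports.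

Local Open Scope classical_set_scope.
Local Open Scope ring_scope.

(** * Change of measure for product laws with a square-integrable density *)

(* Induction on n, splitting off the first observation z and using the bound
   for the fibre over z with lam * f z in place of lam. *)
Lemma product_power_le_square_density d (Z : measurableType d) (R : realType)
    (P Q : probability Z R) (f : Z -> R) (M : R) :
  measurable_fun [set: Z] f -> (forall z, 0 < f z) ->
  (forall g : Z -> \bar R, measurable_fun [set: Z] g ->
    (forall z, (0 <= g z)%E) ->
    (\int[P]_z g z = \int[Q]_z ((f z)%:E * g z))%E) ->
  (\int[Q]_z (f z ^+ 2)%:E <= M%:E)%E ->
  forall n (A : set (n.-tuple Z)) (lam : R), measurable A -> 0 < lam ->
  (product_power P n A <=
     (lam / 2 * M ^+ n)%:E + ((2 * lam)^-1)%:E * product_power Q n A)%E.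
Proof.
move=> mf f0 PQ fM.
have M0 : 0 <= M.
  rewrite -lee_fin (le_trans _ fM)//; apply: integral_ge0 => z _.
  by rewrite lee_fin sqr_ge0.
elim=> [|n IH] A lam mA lam0.
  rewrite /= !diracE expr0 mulr1; case: (_ \in A) => /=; last first.
    by rewrite mule0 adde0 lee_fin divr_ge0// ltW.
  (* On the empty sample the claim is the arithmetic-geometric inequality
     [lam / 2 + 1 / (2 * lam) >= 1]. *)
  rewrite mule1 -EFinD lee_fin invfM -subr_ge0.
  have -> : lam / 2 + 2^-1 / lam - 1 = (lam - 1) ^+ 2 / (2 * lam).
    by field; rewrite gt_eqF.
  by rewrite divr_ge0 ?sqr_ge0// mulr_ge0// ltW.
have mB : measurable (@tuple_cons _ Z n @^-1` A).
  by rewrite -[X in measurable X]setTI; exact: measurable_tuple_cons.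
rewrite /= /distribution /pushforward /= /product_measure1.
set B := _ @^-1` A in mB *.
have mP := measurable_fun_xsection (product_power P n) mB.
have mQ := measurable_fun_xsection (product_power Q n) mB.
rewrite PQ//.
have mf2 : measurable_fun [set: Z] (fun z => (f z ^+ 2)%:E).
  by apply/measurable_EFinP; exact: measurable_funX.
have c0 : 0 <= lam / 2 * M ^+ n by rewrite mulr_ge0 ?exprn_ge0// divr_ge0// ltW.
have k0 : 0 <= (2 * lam)^-1 by rewrite invr_ge0 mulr_ge0// ltW.
(* Multiplying the fibre bound at [lam * f z] by the density [f z] produces [f z ^+ 2] in the first
   term and cancels [f z] in the second. The square then integrates to at most [M], which is the
   extra factor needed. *)
apply: (@le_trans _ _ (\int[Q]_z ((lam / 2 * M ^+ n)%:E * (f z ^+ 2)%:E +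
    ((2 * lam)^-1)%:E * (product_power Q n \o xsection B) z))%E).
  apply: ge0_le_integral => //.
  - by move=> z _; rewrite mule_ge0// lee_fin ltW.
  - by apply: emeasurable_funM => //; exact/measurable_EFinP.
  - by apply: emeasurable_funD; exact: measurable_funeM.
  move=> z _ /=.
  have := IH (xsection B z) (lam * f z) (measurable_xsection z mB)
             (mulr_gt0 lam0 (f0 z)).
  have fz0 := f0 z.
  rewrite -(@lee_pmul2l _ (f z)%:E)//.
  move/le_trans; apply.
  rewrite ge0_muleDr ?mule_ge0 ?lee_fin//; last 2 first.
  - by rewrite mulr_ge0 ?exprn_ge0// divr_ge0// mulr_ge0// ltW.
  - by rewrite invr_ge0 !mulr_ge0// ltW.
  rewrite muleA -!EFinM le_eqVlt; apply/orP; left; apply/eqP.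
  congr (_%:E + _%:E * _)%E; first by ring.
  by field; rewrite !gt_eqF.
rewrite ge0_integralD//; last 4 first.
- by move=> z _; rewrite mule_ge0// lee_fin// sqr_ge0.
- exact: measurable_funeM.
- by move=> z _; rewrite mule_ge0// lee_fin.
- exact: measurable_funeM.
rewrite !ge0_integralZl_EFin//; last by move=> z _; rewrite lee_fin sqr_ge0.
rewrite leeD2r// exprSr mulrA [leRHS]EFinM.
by apply: lee_wpmul2l => //; rewrite lee_fin.
Qed.

(** * Disagreement probability as a pseudometric on classifiers *)

Lemma indic_bool (T : Type) (R : pzRingType) (b : T -> bool) (x : T) :
  \1_[set y | b y] x = (b x)%:R :> R.
Proof. by rewrite indicE; congr ((nat_of_bool _)%:R); apply/idP/idP; rewrite inE. Qed.

Lemma measurable_disagreement d (T : measurableType d) (s t : T -> bool) :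
  measurable_fun [set: T] s -> measurable_fun [set: T] t ->
  measurable [set x | s x != t x].
Proof.
move=> ms mt.
have m : measurable_fun [set: T] (fun x => s x != t x).
  rewrite (_ : (fun x => _) = fun x => if s x then ~~ t x else t x).
    by apply: measurable_fun_ifT => //; exact: measurable_neg.
  by apply/funext => x; case: (s x); case: (t x).
have := m measurableT [set true] I; rewrite setTI.
by congr measurable; apply/seteqP; split=> x /=.
Qed.

Section disagreement.
Context d (T : measurableType d) (R : realType) (mu : probability T R).
Implicit Types s t u : T -> bool.

Definition disagreement s t : R := fine (mu [set x | s x != t x]).

Lemma disagreement_ge0 s t : 0 <= disagreement s t.
Proof. by rewrite /disagreement fine_ge0. Qed.

Lemma disagreementC s t : disagreement s t = disagreement t s.
Proof.
by rewrite /disagreement; congr (fine (mu _)); apply/seteqP; split=> x /=;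
  rewrite eq_sym.
Qed.

Lemma disagreementE s t : measurable_fun [set: T] s -> measurable_fun [set: T] t ->
  mu [set x | s x != t x] = (disagreement s t)%:E.
Proof.
move=> ms mt; rewrite /disagreement fineK//.
by apply: fin_num_measure; exact: measurable_disagreement.
Qed.

Lemma disagreement_triangle s t u : measurable_fun [set: T] s ->
  measurable_fun [set: T] t -> measurable_fun [set: T] u ->
  disagreement s t <= disagreement s u + disagreement u t.
Proof.
move=> ms mt mfu; rewrite -lee_fin EFinD -!disagreementE//.
apply: (le_trans _ (measureU2 mu (measurable_disagreement ms mfu)
                              (measurable_disagreement mfu mt))).
apply: le_measure; rewrite ?inE; first exact: measurable_disagreement.
  by apply: measurableU; exact: measurable_disagreement.
by move=> x /=; case: (s x); case: (t x); case: (u x) => //= _; [right|left|left|right].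
Qed.

(** The difference of two 0/1-valued functions has absolute value the indicator of the set where
    they differ. *)
Lemma L1_distE s t : measurable_fun [set: T] s -> measurable_fun [set: T] t ->
  L1_dist mu s t = (disagreement s t)%:E.
Proof.
move=> ms mt; have mD := measurable_disagreement ms mt.
rewrite -disagreementE// /L1_dist Lnorm1 -[in RHS](setIT [set x | s x != t x]).
rewrite -integral_indic//; apply: eq_integral => x _; rewrite indic_bool /=.
by congr EFin; case: (s x); case: (t x); rewrite /= ?subrr ?subr0 ?sub0r ?normrN
  ?normr0 ?normr1.
Qed.

End disagreement.

(** * Laws with symmetric label noise: margin, excess risk and likelihood ratio *)

Section symmetric_noise.
Context d (T : measurableType d) (R : realType).

(* z.2 tells whether the label agrees with the classifier. *)
Definition noisy_label (t : T -> bool) (z : T * bool) : T * bool :=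
  (z.1, if t z.1 then z.2 else ~~ z.2).

Lemma measurable_noisy_label (t : {mfun T >-> bool}) :
  measurable_fun [set: T * bool] (noisy_label t).
Proof.
apply: measurable_fun_pair => //.
apply: measurable_fun_ifT => //; last exact: measurable_neg.
by apply: measurableT_comp.
Qed.

HB.instance Definition _ (t : {mfun T >-> bool}) :=
  isMeasurableFun.Build _ _ _ _ (noisy_label t) (measurable_noisy_label t).

Definition noisy_law (mu : probability T R) (h : R) (t : {mfun T >-> bool}) :
    probability (T * bool)%type R :=
  distribution (mu \x bernoulli_prob ((1 + h) / 2))%E (noisy_label t).

Definition noisy_regression (h : R) (t : T -> bool) (x : T) : R :=
  if t x then (1 + h) / 2 else (1 - h) / 2.

Variables (mu : probability T R) (h : R).
Hypothesis h01 : 0 <= h <= 1.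

Let p0 : 0 <= (1 + h) / 2.
Proof. by case/andP: h01 => *; lra. Qed.

Let q0 : 0 <= (1 - h) / 2.
Proof. by case/andP: h01 => *; lra. Qed.

Lemma integral_noisy_law (t : {mfun T >-> bool}) (g : T * bool -> \bar R) :
  measurable_fun [set: T * bool] g -> (forall z, (0 <= g z)%E) ->
  (\int[noisy_law mu h t]_z g z =
   \int[mu]_x (((1 + h) / 2)%:E * g (x, t x) +
               ((1 - h) / 2)%:E * g (x, ~~ t x)))%E.
Proof.
move=> mg g0; rewrite ge0_integral_distribution// fubini_tonelli1//; last 2 first.
- exact: (measurableT_comp mg (measurable_noisy_label t)).
- by move=> z; exact: g0.
apply: eq_integral => x _; rewrite /fubini_F integral_bernoulli_prob//=;
  last by case/andP: h01 => *; lra.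
rewrite /noisy_label/= (_ : unstable.onem _ = (1 - h) / 2); first by case: (t x).
by rewrite /unstable.onem; field.
Qed.

Lemma noisy_lawE (t : {mfun T >-> bool}) (B : set (T * bool)) : measurable B ->
  noisy_law mu h t B =
  (\int[mu]_x ((1 + h) / 2 * \1_B (x, t x) +
               (1 - h) / 2 * \1_B (x, ~~ t x))%:E)%E.
Proof.
move=> mB; rewrite -[B in LHS]setIT -integral_indic// integral_noisy_law//.
by apply/measurable_EFinP.
Qed.

Lemma noisy_law_margin (t : {mfun T >-> bool}) (A : set T) : measurable A ->
  noisy_law mu h t (A `*` [set: bool]) = mu A.
Proof.
move=> mA; rewrite noisy_lawE; last exact: measurableX.
rewrite -[A in RHS]setIT -integral_indic//; apply: eq_integral => x _.
by congr EFin; rewrite !indicE !in_setX !in_setT !andbT; field.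
Qed.

Lemma measurable_noisy_regression (t : {mfun T >-> bool}) :
  measurable_fun [set: T] (noisy_regression h t).
Proof. exact: measurable_fun_ifT. Qed.

Lemma noisy_law_regression (t : {mfun T >-> bool}) :
  regression_function (noisy_law mu h t) (noisy_regression h t).
Proof.
have n01 x : 0 <= noisy_regression h t x <= 1.
  by case/andP: h01 => *; rewrite /noisy_regression; case: (t x); lra.
split => // [|A mA]; first exact: measurable_noisy_regression.
have mAT : measurable (A `*` [set: bool]) by exact: measurableX.
have mn : measurable_fun [set: T * bool] (fun z => noisy_regression h t z.1).
  exact: measurableT_comp (measurable_noisy_regression t) _.
rewrite noisy_lawE; last exact: measurableX.
rewrite [RHS]integral_mkcond epatch_indic integral_noisy_law; last 2 first.
- by apply: emeasurable_funM; exact/measurable_EFinP.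
- by move=> z; rewrite -EFinM lee_fin mulr_ge0//; case/andP: (n01 z.1).
apply: eq_integral => x _; rewrite -!EFinM -EFinD; congr EFin.
have set1 b : (b \in [set true]) = b by case: b; [rewrite mem_set|rewrite memNset].
rewrite !indicE !in_setX !in_setT !set1 /noisy_regression /=.
by case: (t x); case: (x \in A) => /=; field.
Qed.

(** Positivity of [h] excludes the tie [eta = 1/2], which [bayes_classifier] resolves to [true]
    everywhere. *)
Lemma noisy_bayes (t : T -> bool) : 0 < h ->
  bayes_classifier (noisy_regression h t) = t.
Proof.
move=> h0; apply/funext => x; rewrite /bayes_classifier /noisy_regression.
by case: (t x); [|apply/negbTE; rewrite -ltNge]; lra.
Qed.

(** The margin [h'] of the class may be smaller than that of the law. This is what lets small
    margins be treated through a larger one. *)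
Lemma noisy_margin_class (h' : R) (S : set (T -> bool)) (t : {mfun T >-> bool}) :
  h' <= h -> 0 < h -> S t ->
  margin_class h' S mu (noisy_law mu h t, noisy_regression h t).
Proof.
move=> h'h h0 St; split => /=.
- exact: noisy_law_regression.
- by move=> A; exact: noisy_law_margin.
- move=> x; apply: le_trans h'h _; rewrite /noisy_regression; case: (t x).
    by rewrite (_ : _ - 1 = h) ?ler_norm//; field.
  by rewrite (_ : _ - 1 = - h) ?normrN ?ler_norm//; field.
- by rewrite noisy_bayes.
Qed.

(** The conditional error is [(1 - h) / 2] where [s] agrees with [t] and [(1 + h) / 2] where it does
    not; the gap is [h]. *)
Lemma noisy_risk (t : {mfun T >-> bool}) (s : T -> bool) :
  measurable_fun [set: T] s ->
  risk (noisy_law mu h t) s =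
  (1 - h) / 2 + h * disagreement mu t s.
Proof.
move=> ms; rewrite /disagreement; have mD : measurable [set x | t x != s x].
  exact: measurable_disagreement.
rewrite /risk noisy_lawE; last first.
  apply: (@measurable_disagreement _ _ snd (s \o fst)) => //.
  exact: measurableT_comp.
have muD : mu [set x | t x != s x] \is a fin_num by exact: fin_num_measure.
transitivity (fine (\int[mu]_x (((1 - h) / 2)%:E +
                     h%:E * (\1_[set x | t x != s x] x)%:E)))%E.
  congr fine; apply: eq_integral => x _; rewrite -EFinM -EFinD; congr EFin.
  rewrite !indic_bool /=.
  by case: (t x); case: (s x) => /=; field.
rewrite ge0_integralD//; last 2 first.
- by move=> x _; rewrite mule_ge0// lee_fin//; case/andP: h01.
- by apply: measurable_funeM; apply/measurable_EFinP.
rewrite integral_cst// [X in (_ * X + _)%E](probability_setT mu) mule1.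
rewrite ge0_integralZl_EFin//; last 2 first.
- by apply/measurable_EFinP.
- by case/andP: h01.
by rewrite integral_indic// setIT fineD ?fin_numM// fineM.
Qed.

Lemma noisy_excess_risk (t : {mfun T >-> bool}) (s : T -> bool) :
  measurable_fun [set: T] s ->
  excess_risk (noisy_law mu h t) t s = h * disagreement mu t s.
Proof.
move=> ms; rewrite /excess_risk !noisy_risk// /disagreement.
have t0 : [set x | t x != t x] = set0.
  by apply/seteqP; split=> x //=; rewrite eqxx.
by rewrite t0 measure0 /= mulr0 addr0 addrAC subrr add0r.
Qed.

(** Density of [noisy_law mu h t] with respect to [noisy_law mu h s], for [h < 1]. The two laws have
    the same conditional label probabilities where [s] and [t] agree and exchange them elsewhere. *)
Definition noisy_density (s t : T -> bool) (z : T * bool) : R :=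
  if t z.1 == s z.1 then 1
  else if z.2 == t z.1 then (1 + h) / (1 - h) else (1 - h) / (1 + h).

Lemma measurable_noisy_density (s t : {mfun T >-> bool}) :
  measurable_fun [set: T * bool] (noisy_density s t).
Proof.
have meq (f g : T * bool -> bool) : measurable_fun [set: T * bool] f ->
    measurable_fun [set: T * bool] g ->
    measurable_fun [set: T * bool] (fun z => f z == g z).
  move=> mf mg; rewrite (_ : (fun z => _) = fun z => if f z then g z else ~~ g z).
    by apply: measurable_fun_ifT => //; exact: measurable_neg.
  by apply/funext => z; case: (f z); case: (g z).
apply: measurable_fun_ifT => //.
  by apply: meq; exact: measurableT_comp.
by apply: measurable_fun_ifT => //; apply: meq => //; exact: measurableT_comp.
Qed.

Lemma noisy_density_gt0 (s t : T -> bool) z : h < 1 -> 0 < noisy_density s t z.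
Proof.
move=> h1; case/andP: h01 => h0 _.
by rewrite /noisy_density; do 2 case: ifP => // _; rewrite divr_gt0//; lra.
Qed.

Lemma noisy_law_density (s t : {mfun T >-> bool}) (g : T * bool -> \bar R) :
  h < 1 -> measurable_fun [set: T * bool] g -> (forall z, (0 <= g z)%E) ->
  (\int[noisy_law mu h t]_z g z =
   \int[noisy_law mu h s]_z ((noisy_density s t z)%:E * g z))%E.
Proof.
move=> h1 mg g0; have [h0 _] := andP h01.
rewrite !integral_noisy_law//; last 2 first.
- apply: emeasurable_funM => //; apply/measurable_EFinP.
  exact: measurable_noisy_density.
- by move=> z; rewrite mule_ge0// lee_fin ltW// noisy_density_gt0.
have u0 : 1 + h != 0 by rewrite gt_eqF//; lra.
have v0 : 1 - h != 0 by rewrite gt_eqF//; lra.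
apply: eq_integral => x _; rewrite /noisy_density !muleA -!EFinM /=.
by case: (t x); case: (s x); rewrite /= ?mulr1// addeC; congr (_%:E * _ + _%:E * _)%E;
  field; rewrite ?u0 ?v0.
Qed.

(** Where [s] and [t] differ, the conditional second moment is
    [((1 + h)^3 + (1 - h)^3) / (2 (1 - h^2))], that is [1 + 4 h^2 / (1 - h^2)]; elsewhere it is
    1. *)
Lemma integral_noisy_density_sqr (s t : {mfun T >-> bool}) : h < 1 ->
  (\int[noisy_law mu h s]_z (noisy_density s t z ^+ 2)%:E =
   1 + (4 * h ^+ 2 / (1 - h ^+ 2))%:E * mu [set x | t x != s x])%E.
Proof.
move=> h1; have [h0 _] := andP h01.
have mD : measurable [set x | t x != s x] by exact: measurable_disagreement.
have u0 : 1 + h != 0 by rewrite gt_eqF//; lra.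
have v0 : 1 - h != 0 by rewrite gt_eqF//; lra.
have c0 : 0 <= 4 * h ^+ 2 / (1 - h ^+ 2).
  by rewrite divr_ge0 ?mulr_ge0 ?sqr_ge0// subr_ge0 expr_le1// ltW.
rewrite integral_noisy_law//; last 2 first.
- by apply/measurable_EFinP/measurable_funX; exact: measurable_noisy_density.
- by move=> z; rewrite lee_fin sqr_ge0.
transitivity (\int[mu]_x (1 + (4 * h ^+ 2 / (1 - h ^+ 2))%:E *
                     (\1_[set x | t x != s x] x)%:E))%E.
  apply: eq_integral => x _; rewrite indic_bool -!EFinM -!EFinD; congr EFin.
  have w0 : 1 - h ^+ 2 != 0.
    by rewrite (_ : _ - _ = (1 + h) * (1 - h)) ?mulf_neq0//; ring.
  rewrite /noisy_density /=.
  by case: (t x); case: (s x) => /=; field; rewrite ?u0 ?v0 ?w0.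
rewrite ge0_integralD//; last 2 first.
- by move=> x _; rewrite mule_ge0// lee_fin.
- by apply: measurable_funeM; apply/measurable_EFinP.
rewrite integral_cst// [X in (_ * X + _)%E](probability_setT mu) mule1.
rewrite ge0_integralZl_EFin//; last by apply/measurable_EFinP.
by rewrite integral_indic// setIT.
Qed.

End symmetric_noise.

(** * From a separated family inside a ball to a lower bound on the minimax risk *)

Lemma trivIset_small d (Z : measurableType d) (R : realType)
    (P : probability Z R) N (A : 'I_N -> set Z) : (0 < N)%N ->
  (forall i, measurable (A i)) -> trivIset [set: 'I_N] A ->
  exists i, (P (A i) <= (N%:R^-1)%:E)%E.
Proof.
move=> N0 mA tA; apply/not_existsP => nA.
have Pfin i : P (A i) = (fine (P (A i)))%:E.
  by rewrite fineK//; exact: fin_num_measure.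
have : (\sum_(i < N) P (A i) <= 1)%E.
  rewrite -(measure_bigsetU_ord P xpredT mA tA).
  by apply: probability_le1; exact: bigsetU_measurable.
under eq_bigr do rewrite Pfin.
rewrite sumEFin lee_fin leNgt => /negP; apply.
have -> : 1 = \sum_(i < N) N%:R^-1 :> R.
  by rewrite sumr_const card_ord -[RHS]mulr_natr mulVf// pnatr_eq0 -lt0n.
apply: ltr_sum => [|i _]; first by apply/hasP; exists (Ordinal N0); rewrite ?mem_index_enum.
by rewrite -lte_fin -Pfin ltNge; apply/negP; exact: nA.
Qed.

Section minimax.
Context d (T : measurableType d) (R : realType) (mu : probability T R).
Variable S : set (T -> bool).
Hypothesis mS : forall t, S t -> measurable_fun [set: T] t.

(** The supremum over an empty class would be [-oo], so a law must be exhibited: the noiseless one,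
    with margin 1, lies in the class for every [h <= 1], and its excess risk is a disagreement
    probability. *)
Lemma minimax_risk_ge0 n (h : R) : 0 <= h <= 1 -> S !=set0 ->
  (0 <= minimax_risk n h S mu)%E.
Proof.
move=> /andP[h0 h1] [t St]; apply: le_ereal_inf_tmp => _ [shat [Sshat _] <-].
have mt := mS St.
pose tm : {mfun T >-> bool} := HB.pack t (isMeasurableFun.Build _ _ _ _ t mt).
have h01 : (0 : R) <= (1 : R) <= (1 : R) by rewrite ?ler01 ?lexx. 
apply: le_ereal_sup_tmp; eexists.
  exists (noisy_law mu 1 tm, noisy_regression 1 tm) => //=.
  by apply: noisy_margin_class => //; exact: St.
apply: expectation_ge0 => w /=.
rewrite noisy_bayes// noisy_excess_risk//; last exact: mS.
by rewrite mul1r disagreement_ge0.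
Qed.

Lemma minimax_risk_ge n N (h' h eps delta : R) (s : T -> bool) (t : 'I_N -> T -> bool) :
  h' <= h -> 0 < h < 1 -> 0 <= eps -> (0 < N)%N ->
  measurable_fun [set: T] s -> (forall i, S (t i)) ->
  (forall i j, i != j -> eps <= disagreement mu (t i) (t j)) ->
  (forall i, disagreement mu (t i) s <= delta) ->
  (1 + 4 * h ^+ 2 / (1 - h ^+ 2) * delta) ^+ n <= N%:R / 4 ->
  ((h * eps / 4)%:E <= minimax_risk n h' S mu)%E.
Proof.
move=> h'h /andP[h0 h1] eps0 N0 ms St sep near_s chi2.
have h01 : 0 <= h <= 1 by rewrite !ltW.
have mt i := mS (St i).
pose sm : {mfun T >-> bool} := HB.pack s (isMeasurableFun.Build _ _ _ _ s ms).
pose tm i : {mfun T >-> bool} :=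
  HB.pack (t i) (isMeasurableFun.Build _ _ _ _ (t i) (mt i)).
pose P i := noisy_law mu h (tm i).
pose Q := noisy_law mu h sm.
apply: le_ereal_inf_tmp => _ [shat [Sshat mshat] <-].
have PS i : margin_class h' S mu (P i, noisy_regression h (tm i)).
  by apply: noisy_margin_class => //; exact: St.
pose X i w := h * disagreement mu (t i) (shat w).
have XE i : (fun w => excess_risk (P i)
    (bayes_classifier (noisy_regression h (tm i))) (shat w)) = X i.
  by apply/funext => w; rewrite noisy_bayes// noisy_excess_risk//; exact: mS.
have mX i : measurable_fun [set: n.-tuple (T * bool)] (X i).
  by rewrite -XE; exact: mshat (PS i).
(* As [h > 0], this is the event that the estimator is at distance less than [eps / 2] from [t i].
   By the triangle inequality, two such events cannot meet. *)
pose A i := [set w | X i w < h * eps / 2].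
have mA i : measurable (A i).
  rewrite (_ : A i = [set: n.-tuple (T * bool)] `&` X i @^-1` `]-oo, h * eps / 2[).
    by apply: mX.
  by rewrite setTI; apply/seteqP; split=> w; rewrite /A /= in_itv.
have tA : trivIset [set: 'I_N] A.
  apply/trivIsetP => i j _ _ ij; apply/seteqP; split=> w //= -[].
  rewrite /A /= /X -!mulrA !ltr_pM2l// => Ai Aj.
  have := disagreement_triangle mu (mt i) (mt j) (mS (Sshat w)).
  by rewrite [X in _ <= _ + X]disagreementC; have := sep _ _ ij; lra.
have [i Qi] := trivIset_small (product_power Q n) N0 mA tA.
have NR : 0 < N%:R :> R by rewrite ltr0n.
(* The choice [lam = 2 / N] makes the first term [M ^+ n / N], at most [1 / 4] by [chi2], and the
   second [(N / 4) * (1 / N)]. *)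
have PA : (product_power (P i) n (A i) <= (2^-1)%:E)%E.
  apply: le_trans (@product_power_le_square_density _ _ _ (P i) Q
    (noisy_density h sm (tm i)) (1 + 4 * h ^+ 2 / (1 - h ^+ 2) * delta) _ _ _ _
    n (A i) (2 / N%:R) (mA i) _) _.
  - exact: measurable_noisy_density.
  - by move=> z; exact: noisy_density_gt0.
  - by move=> g mg g0; exact: noisy_law_density.
  - rewrite integral_noisy_density_sqr// disagreementE// EFinD leeD2l// [leRHS]EFinM.
    apply: lee_wpmul2l; last by rewrite lee_fin; exact: near_s.
    have [h0' h1'] := (ltW h0, ltW h1).
    by rewrite lee_fin divr_ge0 ?mulr_ge0// subr_ge0 expr_le1.
  - by rewrite divr_gt0.
  rewrite [leRHS](_ : _ = (4^-1)%:E + (4^-1)%:E)%E; last first.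
    by rewrite -EFinD; congr EFin; field.
  apply: leeD.
    rewrite lee_fin (_ : _ / 2 = N%:R^-1); last by field; rewrite gt_eqF.
    by rewrite ler_pdivrMl.
  have -> : (2 * (2 / N%:R))^-1 = N%:R / 4 :> R.
    by field; rewrite gt_eqF.
  apply: le_trans (lee_wpmul2l _ Qi) _; first by rewrite lee_fin divr_ge0.
  by rewrite -EFinM lee_fin [leLHS](_ : _ = 4^-1)//; field; rewrite gt_eqF.
apply: le_ereal_sup_tmp; eexists.
  by exists (P i, noisy_regression h (tm i)); [exact: PS|reflexivity].
have mAC : measurable (~` A i) by exact: measurableC.
have he0 : 0 <= h * eps / 2 by rewrite divr_ge0// mulr_ge0// ltW.
rewrite XE unlock.
(* Markov's inequality: the loss is at least [h * eps / 2] off [A i], an event of probability at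
   least [1 / 2]. *)
apply: (@le_trans _ _ (\int[product_power (P i) n]_w
    ((h * eps / 2)%:E * (\1_(~` A i) w)%:E))%E); last first.
  apply: ge0_le_integral => //.
  - by move=> w _; rewrite mule_ge0// lee_fin.
  - by apply: measurable_funeM; apply/measurable_EFinP.
  - exact/measurable_EFinP.
  move=> w _; rewrite -EFinM lee_fin indicE.
  have X0 : 0 <= X i w by rewrite mulr_ge0 ?disagreement_ge0// ltW.
  case: (boolP (w \in _)) => [|_]; last by rewrite mulr0.
  by rewrite inE /A /= => /negP; rewrite -leNgt mulr1.
rewrite ge0_integralZl_EFin//; last exact/measurable_EFinP.
rewrite integral_indic// setIT.
rewrite [X in (_ <= _ * X)%E](probability_setC (product_power (P i) n) (mA i)).
rewrite (_ : h * eps / 4 = h * eps / 2 * 2^-1); last by field.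
rewrite EFinM lee_wpmul2l ?lee_fin//.
have -> : (2^-1%:E = 1 - 2^-1%:E :> \bar R)%E by rewrite -EFinB; congr EFin; field.
by rewrite leeB.
Qed.

End minimax.

(** * Maximal separated families and local packings *)

Lemma pigeonhole_fiber M N (f : 'I_M -> 'I_N) : (0 < M)%N ->
  exists j, (M <= N * #|[set i | f i == j]%SET|)%N.
Proof.
move=> M0; apply/not_existsP => nf.
have N0 : (0 < N)%N by case: (f (Ordinal M0)) => m; exact: leq_ltn_trans.
have sumM : (\sum_(j < N) #|[set i | f i == j]%SET| = M)%N.
  rewrite -[RHS]card_ord -sum1_card (partition_big f xpredT)//=.
  by apply: eq_bigr => j _; rewrite -sum1_card; apply: eq_bigl => i; rewrite inE.
have : (\sum_(j < N) N * #|[set i | f i == j]%SET| < \sum_(j < N) M)%N.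
  apply: (@leq_trans (\sum_(j < N) (1 + N * #|[set i | f i == j]%SET|))%N).
    by rewrite big_split /= sum1_card card_ord -[leqLHS]add1n leq_add2r.
  by apply: leq_sum => j _; rewrite add1n ltnNge; exact/negP.
by rewrite -big_distrr /= sumM sum_nat_const card_ord ltnn.
Qed.

Section packing.
Context d (T : measurableType d) (R : realType) (mu : probability T R).
Variable S : set (T -> bool).
Hypothesis mS : forall t, S t -> measurable_fun [set: T] t.

Lemma separated_size_le eps b N : (L1_entropy eps S mu <= b%:E)%E ->
  Defs.separated eps S mu N -> N%:R <= expR b.
Proof.
move=> entb sepN; have [->|N0] := posnP N; first exact: expR_ge0.
have NR : 0 < N%:R :> R by rewrite ltr0n.
rewrite -[leLHS]lnK// ler_expR -lee_fin -lne_EFin//.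
apply: le_trans entb; rewrite /L1_entropy; set A := [set _ | _ in _].
have NA : (N%:R%:E <= ereal_sup A)%E by apply: ereal_sup_ubound; exists N.
rewrite lee_lne// in_itv/= leey andbT ?lee_fin ?ler0n//.
by apply: le_trans NA; rewrite lee_fin.
Qed.

(** A finite entropy bounds the sizes of separated families, so the supremum defining it is
    attained. *)
Lemma maximal_separated eps b : (L1_entropy eps S mu <= b%:E)%E ->
  exists N, [/\ Defs.separated eps S mu N, ~ Defs.separated eps S mu N.+1 &
                L1_entropy eps S mu = lne (N%:R)%:E].
Proof.
move=> entb.
have sep0 : exists N, `[< Defs.separated eps S mu N >].
  exists 0%N; apply/asboolP; exists (fun _ _ => true).
  by split; case.
have ub N : `[< Defs.separated eps S mu N >] -> (N <= Num.bound (expR b))%N.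
  move=> /asboolP/(separated_size_le entb) Nb.
  by rewrite -(ler_nat R) (le_trans Nb)// ltW// archi_boundP// expR_ge0.
have [N /asboolP sepN maxN] := ex_maxnP sep0 ub.
exists N; split => //.
  by move=> /asboolP/maxN; rewrite ltnn.
rewrite /L1_entropy; congr lne; apply/eqP; rewrite eq_le; apply/andP; split.
  apply: ge_ereal_sup => _ [M sepM <-]; rewrite lee_fin ler_nat.
  by apply: maxN; apply/asboolP.
by apply: ereal_sup_ubound; exists N.
Qed.

(** A member of [S] farther than [eps] from every [t i] could be added to the family, against
    maximality. *)
Lemma maximal_separated_cover eps N (t : 'I_N -> T -> bool) :
  (forall i, S (t i)) ->
  (forall i j, i != j -> (eps%:E < L1_dist mu (t i) (t j))%E) ->
  ~ Defs.separated eps S mu N.+1 ->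
  forall s, S s -> exists i, disagreement mu s (t i) <= eps.
Proof.
move=> St sept nsep s Ss; apply: contrapT => ns; apply: nsep.
have far i : (eps%:E < L1_dist mu s (t i))%E.
  rewrite L1_distE; [|exact: mS..]; rewrite lte_fin ltNge.
  by apply/negP => le; apply: ns; exists i.
have sym u v : S u -> S v -> L1_dist mu u v = L1_dist mu v u.
  by move=> Su Sv; rewrite !L1_distE 1?disagreementC//; exact: mS.
exists (fun i => if unlift ord_max i is Some j then t j else s); split.
  by move=> i; case: unliftP.
move=> i j; case: (unliftP ord_max i) => [i' ->|->];
  case: (unliftP ord_max j) => [j' ->|->].
- by rewrite (inj_eq lift_inj) => ij; exact: sept.
- by move=> _; rewrite sym.
- by move=> _; exact: far.
- by rewrite eqxx.
Qed.

(** A maximal [eps]-separated family has at least [expR a] members, each within [eps'] of one of at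
    most [expR b'] centers. Some center therefore has at least [expR (a - b')] of them around it.
    The bound [b] ensures that the maximal family exists. *)
Lemma local_packing eps eps' a b b' :
  (a%:E <= L1_entropy eps S mu)%E -> (L1_entropy eps S mu <= b%:E)%E ->
  (L1_entropy eps' S mu <= b'%:E)%E ->
  exists N (s : T -> bool) (t : 'I_N -> T -> bool),
    [/\ S s, forall i, S (t i),
        forall i j, i != j -> eps <= disagreement mu (t i) (t j),
        forall i, disagreement mu (t i) s <= eps' &
        expR (a - b') <= N%:R].
Proof.
move=> enta entb entb'.
have [M [[t [St sept]] _ entM]] := maximal_separated entb.
have [N [sepN nsepN _]] := maximal_separated entb'.
have [s [Ss seps]] := sepN.
(* An empty maximal family would have entropy [-oo], below the real number [a]. *)
have M0 : (0 < M)%N.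
  rewrite lt0n; apply/eqP => M0; move: enta.
  by rewrite entM M0 le0_lneNy// leNgt ltNyr.
have aM : expR a <= M%:R.
  have MR : 0 < M%:R :> R by rewrite ltr0n.
  move: enta; rewrite entM lne_EFin// lee_fin => aM.
  by rewrite -[leRHS]lnK// ler_expR.
have cover i : exists j, disagreement mu (t i) (s j) <= eps'.
  exact: maximal_separated_cover nsepN _ (St i).
have [f fP] := choice cover.
have [j Mj] := pigeonhole_fiber f M0.
set F := [set i | f i == j]%SET in Mj.
exists #|F|, (s j), (fun k => t (enum_val k)); split => //.
- move=> k l kl; rewrite -lee_fin -L1_distE; [|exact: mS..].
  by rewrite ltW// sept// (inj_eq enum_val_inj).
- by move=> k; have := enum_valP k; rewrite inE => /eqP <-; exact: fP.
rewrite expRD expRN ler_pdivrMr ?expR_gt0//.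
apply: le_trans aM _; apply: (@le_trans _ _ (#|F|%:R * N%:R)).
  by rewrite -natrM ler_nat mulnC.
by rewrite ler_wpM2l// (separated_size_le entb').
Qed.

End packing.

(** * Balancing separation against sample information *)

Lemma le_powR (R : realType) (a b p : R) : 0 <= p -> 0 <= a -> a <= b ->
  a `^ p <= b `^ p.
Proof.
move=> p0 a0 ab; apply: (ge0_ler_powR p0) => //; rewrite nnegrE//.
exact: le_trans ab.
Qed.

(** The condition [1 - h <= n h^2] keeps the chosen radius below a constant, hence in the range
    where the entropy bounds hold. *)
Lemma metric_entropy_minimax_risk_ge (R : realType) (K1 K2 eps0 r : R) :
  0 < K1 -> 0 < K2 -> 0 < eps0 -> 0 < r ->
  exists2 c : R, 0 < c &
    forall d (T : measurableType d) (mu : probability T R) (S : set (T -> bool)),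
      (forall t, S t -> measurable_fun [set: T] t) ->
      (forall eps : R, 0 < eps -> eps <= eps0 ->
         ((K2 * eps `^ (- r))%:E <= L1_entropy eps S mu)%E /\
         (L1_entropy eps S mu <= (K1 * eps `^ (- r))%:E)%E) ->
      forall (n : nat) (h' h : R), h' <= h -> 0 < h < 1 -> 1 - h <= n%:R * h ^+ 2 ->
        ((c * (h * ((1 - h) / (n%:R * h ^+ 2)) `^ (1 / (1 + r))))%:E
          <= minimax_risk n h' S mu)%E.
Proof.
move=> K10 K20 eps00 r0.
have r10 : 0 < 1 + r by rewrite addr_gt0.
(* With [D ^ (- r) = K2 / (2 K1)], the [D eps]-entropy is at most half the
   lower bound on the [eps]-entropy. *)
pose D := (2 * K1 / K2) `^ (1 / r).
have D0 : 0 < D by rewrite powR_gt0// divr_gt0// mulr_gt0.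
have DE : K1 * D `^ (- r) = K2 / 2.
  rewrite -powRrM mulrN div1r mulVf ?gt_eqF// powRN powRr1; last first.
    by rewrite divr_ge0 ?mulr_ge0 ?ltW.
  by field; rewrite !gt_eqF.
pose c := Num.min (Num.min eps0 (eps0 / D))
  (Num.min ((K2 / 12) `^ (1 / r)) ((K2 / (16 * D)) `^ (1 / (1 + r)))).
have c0 : 0 < c.
  by rewrite !lt_min eps00 divr_gt0//= !powR_gt0// divr_gt0// mulr_gt0.
have := lexx c; rewrite {2}/c !le_min => /andP[/andP[ceps0 cD] /andP[c12 c16]].
have powc a b : 0 < a -> 0 < b -> c <= b `^ (1 / a) -> c `^ a <= b.
  move=> a0 b0 cb; rewrite -[leRHS](powRr1 (ltW b0)) -(mulVf (lt0r_neq0 a0)).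
  by rewrite powRrM -[a^-1]div1r le_powR// ltW.
have cr : c `^ r <= K2 / 12 by apply: powc => //; rewrite divr_gt0.
have cr1 : c `^ (1 + r) <= K2 / (16 * D).
  by apply: powc => //; rewrite divr_gt0// mulr_gt0.
exists (c / 4) => [|d T mu S mS ent n h' h h'h /andP[h0 h1] nh].
  by rewrite divr_gt0.
have nh0 : 0 < n%:R * h ^+ 2 by apply: lt_le_trans nh; rewrite subr_gt0.
pose y := (1 - h) / (n%:R * h ^+ 2).
have y0 : 0 < y by rewrite divr_gt0// subr_gt0.
have y1 : y <= 1 by rewrite ler_pdivrMr// mul1r.
pose eps := c * y `^ (1 / (1 + r)).
have epsc : eps <= c.
  rewrite ler_piMr ?(ltW c0)//.
  apply: (@le_trans _ _ (1 `^ (1 / (1 + r)))); last by rewrite powR1.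
  by rewrite le_powR ?(ltW y0)// divr_ge0// ltW.
have eps_gt0 : 0 < eps by rewrite mulr_gt0// powR_gt0.
have [enta entb] := ent eps eps_gt0 (le_trans epsc ceps0).
have [|_ entb'] := ent (D * eps) (mulr_gt0 D0 eps_gt0).
  rewrite mulrC -ler_pdivlMr//; exact: le_trans epsc cD.
have [N [s [t [Ss St sep near_s NE]]]] := local_packing mS enta entb entb'.
move: NE; rewrite (powRM _ (ltW D0) (ltW eps_gt0)) mulrA DE -mulrBl.
rewrite (_ : K2 - K2 / 2 = K2 / 2); last by field.
move=> NE.
have N0 : (0 < N)%N by rewrite -(ltr_nat R) (lt_le_trans _ NE)// expR_gt0.
have epsr : eps `^ r <= K2 / 12.
  by apply: le_trans cr; rewrite le_powR// ltW.
have epsr0 : 0 < eps `^ r by rewrite powR_gt0.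
have epsr1 : eps * eps `^ r <= K2 / (16 * D) * y.
  rewrite -[X in X * _](powRr1 (ltW eps_gt0)) -powRD; last by rewrite gt_eqF ?implybT.
  rewrite powRM ?powR_ge0 ?(ltW c0)// -powRrM div1r mulVf ?gt_eqF//.
  by rewrite (powRr1 (ltW y0)) ler_wpM2r// ltW.
rewrite (_ : _ * _ = h * eps / 4); last by rewrite /eps /y; field.
apply: (minimax_risk_ge mS h'h _ (ltW eps_gt0) N0 (mS _ Ss) St sep near_s).
  by rewrite h0.
have h21 : 0 < 1 - h ^+ 2 by rewrite subr_gt0 expr_lt1// ltW.
set x := _ / _ * _.
have [h0' D0' c0' h21'] := And4 (ltW h0) (ltW D0) (ltW c0) (ltW h21).
have x0 : 0 <= x by rewrite /x !mulr_ge0 ?invr_ge0 ?powR_ge0.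
rewrite powRN in NE.
have three : 3 <= K2 / 4 * (eps `^ r)^-1.
  by rewrite ler_pdivlMr//; move: epsr; lra.
have nx : n%:R * x <= K2 / 4 * (eps `^ r)^-1.
  rewrite ler_pdivlMr// /x.
  have -> : n%:R * (4 * h ^+ 2 / (1 - h ^+ 2) * (D * eps)) * eps `^ r =
      4 * D * (n%:R * h ^+ 2) / (1 - h ^+ 2) * (eps * eps `^ r) by ring.
  apply: (@le_trans _ _ (4 * D * (n%:R * h ^+ 2) / (1 - h ^+ 2) *
                         (K2 / (16 * D) * y))).
    by rewrite ler_wpM2l// !mulr_ge0 ?invr_ge0 ?powR_ge0.
  have u0 : 0 < 1 + h by rewrite addr_gt0.
  rewrite [leLHS](_ : _ = K2 / 4 / (1 + h)).
    by rewrite ler_pdivrMr// ler_peMr ?divr_ge0 ?ltW// ltrDl.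
  have h2E : 1 - h ^+ 2 = (1 + h) * (1 - h) by ring.
  have nR : 0 < n%:R :> R by rewrite -(pmulr_lgt0 _ (exprn_gt0 2 h0)).
  by rewrite /y h2E; field; rewrite !gt_eqF// ?subr_gt0.
(* It remains to use [(1 + x) ^+ n <= expR (n * x)] and [4 <= expR 3]. *)
rewrite ler_pdivlMr//; apply: le_trans NE.
apply: (@le_trans _ _ (expR (n%:R * x) * expR 3)); last first.
  by rewrite -expRD ler_expR; lra.
apply: ler_pM => //; first by rewrite exprn_ge0// addr_ge0.
  by rewrite expRM_natl lerXn2r ?nnegrE ?addr_ge0 ?expR_ge0// expR_ge1Dx.
by apply: le_trans (expR_ge1Dx _); lra.
Qed.

(** * The two regimes of the margin, separated at [n^(-1/2)] *)

Theorem theorem6 (R : realType) (K1 K2 eps0 r : R) :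
  0 < K1 -> 0 < K2 -> 0 < eps0 -> 0 < r ->
  exists K : R, 0 < K /\
    forall (d : measure_display) (T : measurableType d)
      (mu : probability T R) (S : set (T -> bool)),
      (forall t, S t -> measurable_fun [set: T] t) ->
      (forall eps : R, 0 < eps -> eps <= eps0 ->
         ((K2 * eps `^ (- r))%:E <= L1_entropy eps S mu)%E /\
         (L1_entropy eps S mu <= (K1 * eps `^ (- r))%:E)%E) ->
      forall (n : nat) (h : R), (2 <= n)%N -> 0 <= h <= 1 ->
        ((K * (1 - h) `^ (1 / (1 + r)))%:E *
           mine (powR_pinfty h (- ((1 - r) / (1 + r))) *
                   (n%:R `^ (- (1 / (1 + r))))%:E)
                (n%:R `^ (- (1 / 2)))%:E
         <= minimax_risk n h S mu)%E.
Proof.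
move=> K10 K20 eps00 r0.
have r10 : 0 < 1 + r by rewrite addr_gt0.
have a0 : 0 < 1 / (1 + r) by rewrite divr_gt0.
have [c c0 lower] := metric_entropy_minimax_risk_ge K10 K20 eps00 r0.
set a := 1 / (1 + r) in a0 lower *.
pose k := 4^-1 `^ a : R.
have k0 : 0 < k by rewrite powR_gt0// invr_gt0.
have k1 : k <= 1.
  apply: (@le_trans _ _ (1 `^ a)); last by rewrite powR1.
  by rewrite le_powR ?(ltW a0)//; lra.
exists (c * k); split=> [|d T mu S mS ent n h n2 /andP[h0 h1]]; first exact: mulr_gt0.
(* The entropy bounds at [eps0] provide a member of [S]. *)
have [enta entb] := ent eps0 eps00 (lexx _).
have [N [s [_ [Ss _ _ _ _]]]] := local_packing mS enta entb entb.
have [->|hn1] := eqVneq h 1.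
  rewrite subrr powR0 ?gt_eqF// mulr0 mul0e.
  by apply: minimax_risk_ge0 => //; [rewrite ler01 lexx|exists s].
have {hn1} h1 : h < 1 by rewrite lt_neqAle hn1.
have nR : 0 < n%:R :> R by rewrite ltr0n; exact: ltn_trans n2.
set m := n%:R `^ (- (1 / 2)).
have m0 : 0 < m by rewrite powR_gt0.
have nm2 : n%:R * m ^+ 2 = 1.
  rewrite -powR_mulrn ?(ltW m0)// -powRrM mulNr div1r mulVf ?pnatr_eq0// powRN.
  by rewrite powRr1 ?(ltW nR)// mulfV ?gt_eqF.
(* For [h >= m] the minimum is bounded by its first term. Otherwise it is bounded by its second,
   which also covers [h = 0], where the first may be infinite. *)
have [mh|hm] := leP m h.
  have h0' : 0 < h by exact: lt_le_trans mh.
  have nh1 : 1 <= n%:R * h ^+ 2.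
    by rewrite -[leLHS]nm2 ler_pM2l// ler_pXn2r// nnegrE ltW.
  have h01 : 0 < h < 1 by rewrite h0'.
  have hnh : 1 - h <= n%:R * h ^+ 2 by apply: le_trans nh1; lra.
  apply: le_trans (lower d T mu S mS ent n h h (lexx _) h01 hnh).
  rewrite /powR_pinfty gt_eqF//=.
  apply: (@le_trans _ _ ((c * k * (1 - h) `^ a)%:E *
     ((h `^ (- ((1 - r) / (1 + r))))%:E * (n%:R `^ (- a))%:E))%E).
    apply: lee_wpmul2l; last by rewrite ge_min lexx.
    by rewrite lee_fin !mulr_ge0 ?powR_ge0// ltW.
  have [h0n nn] := (ltW h0', ltW nR).
  rewrite -!EFinM lee_fin.
  have -> : ((1 - h) / (n%:R * h ^+ 2)) `^ a =
      (1 - h) `^ a * (n%:R `^ (- a) * h `^ (2 * - a)).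
    rewrite powRM ?invr_ge0 ?subr_ge0 ?(ltW h1) ?mulr_ge0//; congr (_ * _).
    rewrite -powR_inv1 ?mulr_ge0// -powRrM mulN1r powRM ?exprn_ge0//.
    by rewrite -powR_mulrn// -powRrM.
  (* The exponent is [1 - 2 a]: the excess risk contributes [h], the radius [h^(-2a)]. *)
  have -> : h `^ (- ((1 - r) / (1 + r))) = h * h `^ (2 * - a).
    rewrite -[X in _ = X * _](powRr1 h0n) -powRD ?(gt_eqF h0') ?implybT//.
    by congr (_ `^ _); rewrite /a; field; rewrite gt_eqF.
  rewrite [leLHS](_ : _ =
    k * (c * (h * ((1 - h) `^ a * (n%:R `^ (- a) * h `^ (2 * - a))))));
    last by ring.
  by rewrite ler_piMl// !mulr_ge0 ?powR_ge0// ltW.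
have m34 : m <= 3 / 4.
  rewrite -(@ler_pXn2r _ 2) ?nnegrE ?divr_ge0 ?(ltW m0)//.
  have : 2 * m ^+ 2 <= 1 by rewrite -[leRHS]nm2 ler_wpM2r ?sqr_ge0// ler_nat.
  by lra.
have m01 : 0 < m < 1 by rewrite m0; apply: le_lt_trans m34 _; lra.
have mnm : 1 - m <= n%:R * m ^+ 2 by rewrite nm2; lra.
(* Laws of margin [m > h] belong to the class of margin [h], so the bound at [m] applies. *)
apply: le_trans (lower d T mu S mS ent n h m (ltW hm) m01 mnm).
rewrite nm2 divr1.
apply: (@le_trans _ _ ((c * k)%:E * m%:E)%E).
  apply: (@le_trans _ _ ((c * k * (1 - h) `^ a)%:E * m%:E)%E).
    apply: lee_wpmul2l; last by rewrite ge_min lexx orbT.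
    by rewrite lee_fin !mulr_ge0 ?powR_ge0// ltW.
  rewrite -!EFinM lee_fin ler_pM2r// ler_piMr//; first by rewrite ltW// mulr_gt0.
  apply: (@le_trans _ _ (1 `^ a)); last by rewrite powR1.
  by rewrite le_powR ?(ltW a0)//; lra.
rewrite -EFinM lee_fin -mulrA ler_pM2l// mulrC ler_pM2l//.
by rewrite le_powR ?(ltW a0)//; lra.
Qed.
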